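(* Suppose that $\Omega(\bm x)=\frac{1}{2\gamma}\|\bm x\|_2^2$ and that for each $\bm z\in\mathcal Z$, either the subproblem $$\min_{\bm x\in\mathbb R^n}\ g(\bm x)+\Omega(\bm x)\quad\text{s.t.}\quad x_i=0\ \text{if}\ z_i=0\quad\forall i\in[n]$$ is infeasible, or strong duality holds for it. Then the problem $$\min_{\bm z\in\mathcal Z}\ \max_{\bm\alpha\in\mathbb R^n}\ \bm c^\top\bm z+h(\bm\alpha)-\frac{\gamma}{2}\sum_{i=1}^n z_i\,\alpha_i^2$$ is equivalent to the following optimization problem: $$\min_{\bm z\in\mathcal Z}\ \min_{\bm x\in\mathbb R^n}\ \bm c^\top\bm z+g(\bm x)+\frac{1}{2\gamma}\sum_{i=1}^n\begin{cases}\dfrac{x_i^2}{z_i}, & \text{if } z_i>0,\\ 0, & \text{if } z_i=0\text{ and }x_i=0,\\ \infty, & \text{otherwise.}\end{cases}$$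
   Context: Setting: $[n]=\{1,\dots,n\}$, $\mathcal Z\subseteq\{0,1\}^n$, $\bm c\in\mathbb R^n$, $\gamma>0$, and $g$ is a convex function on $\mathbb R^n$, possibly taking the value $+\infty$ (constraints $\bm x\in\mathcal X$ with $\mathcal X\subseteq\mathbb R^n$ convex may be encoded by setting $g(\bm x)=+\infty$ if $\bm x\notin\mathcal X$). The function $h$ is defined by $h(\bm\alpha):=\inf_{\bm v} g(\bm v)-\bm v^\top\bm\alpha$. Strong duality is meant in the usual sense of convex optimization: the optimal value of the minimization problem equals that of its dual.
   Formalization: If the subproblem is infeasible for some z in Z, g is additionally assumed lower semicontinuous (closed); without this the claim fails, e.g. n=1, Z={0}, c=0, g=0 on x>0 and +∞ elsewhere, where the first problem has value 0 and the second +∞. *)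

(* Defs.v *)
From mathcomp Require Import all_boot all_order all_algebra.
From mathcomp Require Import all_classical all_reals all_analysis.

Set Implicit Arguments.
Unset Strict Implicit.
Unset Printing Implicit Defensive.

Import Order.TTheory GRing.Theory Num.Theory.
Import numFieldNormedType.Exports.

Local Open Scope classical_set_scope.
Local Open Scope ring_scope.
Local Open Scope ereal_scope.

Definition dot (R : realType) (n : nat) (u v : 'rV[R]_n) : R :=
  (\sum_(i < n) u ord0 i * v ord0 i)%R.

(* The library norm `|x| on 'rV[R]_n is the sup norm. *)
Definition l2norm (R : realType) (n : nat) (x : 'rV[R]_n) : R :=
  Num.sqrt (\sum_(i < n) x ord0 i ^+ 2)%R.

Definition binary_vector (R : realType) (n : nat) : set 'rV[R]_n :=
  [set z | forall i, z ord0 i = 0%R \/ z ord0 i = 1%R].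

(* The values t = 0 and t = 1 are harmless because 0 * +oo = 0 in \bar R. *)
Definition convex_extended (R : realType) (n : nat) (g : 'rV[R]_n -> \bar R) :=
  forall (x y : 'rV[R]_n) (t : R), (0 <= t <= 1)%R ->
    g (t *: x + (1 - t) *: y)%R <= t%:E * g x + (1 - t)%:E * g y.

Definition supported (R : realType) (n : nat) (z : 'rV[R]_n) : set 'rV[R]_n :=
  [set x | forall i, z ord0 i = 0%R -> x ord0 i = 0%R].

Section Subproblem.
Variables (R : realType) (n : nat).
Variables (g : 'rV[R]_n -> \bar R) (Omega : 'rV[R]_n -> R) (z : 'rV[R]_n).

Definition sub_infeasible : Prop :=
  ~ exists x, supported z x /\ g x < +oo.

Definition sub_primal_value : \bar R :=
  ereal_inf [set g x + (Omega x)%:E | x in supported z].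

(* Lagrangian of the subproblem after splitting it into
     min_(v, x) g v + Omega x  s.t.  v = x, x in supported z,
   with multiplier alpha for x - v = 0; its dual is the Fenchel dual of
   g + (Omega + indicator of supported z). *)
Definition sub_lagrangian (alpha v x : 'rV[R]_n) : \bar R :=
  g v + (Omega x)%:E + (dot alpha (x - v)%R)%:E.

Definition sub_dual_function (alpha : 'rV[R]_n) : \bar R :=
  ereal_inf [set sub_lagrangian alpha p.1 p.2
            | p in [set p : 'rV[R]_n * 'rV[R]_n | supported z p.2]].

Definition sub_dual_value : \bar R := ereal_sup (range sub_dual_function).

Definition strong_duality : Prop := sub_primal_value = sub_dual_value.

End Subproblem.

Definition h_fun (R : realType) (n : nat) (g : 'rV[R]_n -> \bar R)
    (alpha : 'rV[R]_n) : \bar R :=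
  ereal_inf (range (fun v : 'rV[R]_n => g v - (dot v alpha)%:E)).

Definition saddle_objective (R : realType) (n : nat) (c : 'rV[R]_n)
    (gamma : R) (g : 'rV[R]_n -> \bar R) (z : 'rV[R]_n) : \bar R :=
  ereal_sup (range (fun alpha : 'rV[R]_n =>
    (dot c z)%:E + h_fun g alpha
    - (gamma / 2 * \sum_(i < n) z ord0 i * alpha ord0 i ^+ 2)%:E)).

Definition perspective_term (R : realType) (x z : R) : \bar R :=
  if (0 < z)%R then (x ^+ 2 / z)%:E
  else if (z == 0%R) && (x == 0%R) then 0
  else +oo.

Definition perspective_objective (R : realType) (n : nat) (c : 'rV[R]_n)
    (gamma : R) (g : 'rV[R]_n -> \bar R) (z : 'rV[R]_n) : \bar R :=
  ereal_inf (range (fun x : 'rV[R]_n =>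
    (dot c z)%:E + g x
    + (1 / (2 * gamma))%:E
      * \sum_(i < n) perspective_term (x ord0 i) (z ord0 i))).

Definition optimal (R : realType) (T : Type) (Z : set T) (f : T -> \bar R)
    (z : T) : Prop :=
  Z z /\ forall z', Z z' -> f z <= f z'.

Definition equivalent_min (R : realType) (T : Type) (Z : set T)
    (f1 f2 : T -> \bar R) : Prop :=
  [/\ forall z, Z z -> f1 z = f2 z,
      ereal_inf (f1 @` Z) = ereal_inf (f2 @` Z)
    & forall z, optimal Z f1 z <-> optimal Z f2 z].

(* Main.v *)
Require Import Defs.
From mathcomp Require Import all_boot all_order all_algebra.
From mathcomp Require Import all_classical all_reals all_analysis.
From mathcomp Require Import ring lra.

Set Implicit Arguments.
Unset Strict Implicit.
Unset Printing Implicit Defensive.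

Import Order.TTheory GRing.Theory Num.Theory.
Import numFieldNormedType.Exports.
Local Open Scope classical_set_scope.
Local Open Scope ring_scope.
Local Open Scope ereal_scope.

(** For fixed binary [z], minimising the Lagrangian over [x] coordinatewise turns
    the dual function of the subproblem into [h alpha - gamma/2 sum z_i alpha_i^2],
    and the perspective terms are the quadratic [Omega] plus the indicator of the
    support constraint.  Hence the two objectives are [c.z] plus the dual,
    respectively primal, value of the subproblem, and strong duality concludes.

    If the subproblem is infeasible, the primal value is [+oo] and one needs the
    dual value to be [+oo] as well.  Relax the constraint [x_i = 0] to a penalty
    [k/2 x_i^2]: closedness and convexity of [g] provide a minimiser [v] of the
    penalised problem, minus the gradient of its quadratic part at [v] is a
    subgradient of [g], and it is a multiplier whose dual value is at least the
    penalised minimum.  These minima tend to [+oo] with [k]: otherwise the nested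
    compact sublevel sets share a point, which would be feasible. *)

(** * Compactness and lower semicontinuity *)

(** The [F k] are a base of a proper filter on the compact set [F 0], and closedness puts any
    cluster point in every [F k]. *)
Lemma nested_compact_nonempty (T : topologicalType) (F : nat -> set T) :
  compact (F 0%N) -> (forall k, closed (F k)) ->
  (forall k, F k.+1 `<=` F k) -> (forall k, F k !=set0) ->
  exists x, forall k, F k x.
Proof.
move=> F0 Fcl FS Fn0.
have Fle j k : (j <= k)%N -> F k `<=` F j.
  move=> /subnK <-; elim: (k - j)%N => [//|m IH]; rewrite addSn.
  exact: subset_trans (FS _) IH.
have PF : ProperFilter (filter_from setT F).
  apply: filter_from_proper => [|k _]; last exact: Fn0.
  apply: filter_from_filter; first by exists 0%N.
  move=> j k _ _; exists (maxn j k) => //.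
  by move=> x Fx; split; apply: Fle Fx; rewrite ?leq_maxl ?leq_maxr.
have [|x [_ clx]] := F0 _ PF; first by exists 0%N.
exists x => k; apply: Fcl => B nB.
by apply: clx => //; exists k.
Qed.

Section LowerSemicontinuous.
Variables (R : realType) (T : topologicalType).
Implicit Types f : T -> \bar R.

Lemma lsc_closed_sublevel f (a : R) :
  lower_semicontinuous f -> closed [set x | f x <= a%:E].
Proof.
move=> /lower_semicontinuousP lf.
rewrite (_ : [set _ | _] = ~` [set x | a%:E < f x]).
  by rewrite closedC; exact: lf.
by apply/seteqP; split=> x /=; rewrite leNgt => /negP.
Qed.

(** Sublevel sets in [A] at the values [f y] are nested, so they generate a proper filter. At a
    cluster point [x], having [f y < f x] would keep [f] above [f y] on a whole neighbourhood of
    [x]. *)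
Lemma lsc_attains_min f (A : set T) :
  compact A -> A !=set0 -> lower_semicontinuous f -> (forall x, -oo < f x) ->
  exists2 x, A x & forall y, A y -> f x <= f y.
Proof.
move=> cA [a Aa] lf fNy.
have PF : ProperFilter
    (filter_from A (fun y => [set x | A x /\ f x <= f y])).
  apply: filter_from_proper => [|y Ay]; last by exists y.
  apply: filter_from_filter; first by exists a.
  move=> y z Ay Az; have [yz|zy] := leP (f y) (f z).
    by exists y => // x [Ax xy]; split=> //; split=> //; exact: le_trans yz.
  exists z => // x [Ax xz]; split=> //; split=> //.
  exact: le_trans xz (ltW zy).
have [|x [Ax clx]] := cA _ PF; first by exists a => // x [].
exists x => // y Ay; rewrite leNgt; apply/negP => yx.
have fy : f y \is a fin_num by rewrite fin_numElt fNy (lt_le_trans yx)// leey.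
have [|V nV Vf] := lf x (fine (f y)); first by rewrite fineK.
have [|w [[_ wy] Vw]] := clx [set x | A x /\ f x <= f y] V _ nV.
  by exists y.
by have := Vf _ Vw; rewrite fineK// ltNge wy.
Qed.

Lemma lscD_continuous f (q : T -> R) :
  lower_semicontinuous f -> continuous q ->
  lower_semicontinuous (fun x => f x + (q x)%:E).
Proof.
move=> lf cq x a afq.
(* [r] splits the bound [a]: nearby, [f] exceeds [r] and [q] exceeds [a - r]. *)
have [r ar rf] : exists2 r : R, (a - q x < r)%R & r%:E < f x.
  move: afq; case: (f x) => [s| |//].
    rewrite -EFinD lte_fin => h; exists ((a - q x + s) / 2)%R; last rewrite lte_fin; lra.
  by move=> _; exists (a - q x + 1)%R; [lra | rewrite ltry].
have [V nV Vr] := lf _ _ rf.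
have nq : \forall y \near x, (a - r < q y)%R by apply: (cvgr_gt (q x)); [exact: cq | lra].
exists (V `&` [set y | (a - r < q y)%R]); first exact: filterI.
move=> y [Vy /= qy]; have := Vr _ Vy; case: (f y) => [s| |//].
  by rewrite -EFinD !lte_fin; lra.
by move=> _; rewrite addye// ltry.
Qed.

End LowerSemicontinuous.

(** * Coercivity and first-order optimality for a convex function plus a quadratic *)

Section ConvexGrowth.
Variables (R : realType) (n : nat).
Implicit Types (g : 'rV[R]_n -> \bar R) (u v x : 'rV[R]_n).

Lemma compact_norm_le (A : set 'rV[R]_n) (B : R) :
  closed A -> (forall x, A x -> (`|x| <= B)%R) -> compact A.
Proof.
move=> clA AB; apply: bounded_closed_compact => //.
exists B; split; first exact: num_real.
by move=> M BM x /AB /le_trans; apply; exact: ltW.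
Qed.

(** The sup norm is attained at a coordinate, whose square is one term of the sum. *)
Lemma sqr_norm_le_sum x : (`|x| ^+ 2 <= \sum_(i < n) x ord0 i ^+ 2)%R.
Proof.
have [->|x0] := eqVneq x 0%R.
  by rewrite normr0 expr0n /= sumr_ge0// => i _; rewrite sqr_ge0.
have [|[j i]] := @mx_norm_neq0 _ _ _ x; first by rewrite -[mx_norm x]/(`|x|)%R normr_eq0.
rewrite -[mx_norm x]/(`|x|)%R => -> /=; rewrite real_normK ?num_real// ord1.
by rewrite (bigD1 i)//= lerDl sumr_ge0// => k _; rewrite sqr_ge0.
Qed.

(* Compare g v with the point of the segment [x0, v] lying on the unit sphere
   around x0, where g is bounded below by compactness. *)
Lemma convex_lsc_linear_growth g :
  convex_extended g -> lower_semicontinuous g -> (forall x, -oo < g x) ->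
  exists2 C : R, (0 <= C)%R & forall v, (- (C * (1 + `|v|)))%:E <= g v.
Proof.
move=> cvx lg gNy; have [[x0 gx0]|noF] := pselect (exists x, g x < +oo); last first.
  exists 0%R => // v; suff -> : g v = +oo by rewrite leey.
  by apply/eqP; rewrite -leye_eq leNgt; apply/negP => gv; apply: noF; exists v.
have cA : compact (closed_ball x0 1%R).
  apply: (@compact_norm_le _ (`|x0| + 1)%R); first exact: closed_ball_closed.
  move=> x; rewrite closed_ballE// /closed_ball_ /= => hx.
  by have := ler_normB x0 (x0 - x)%R; rewrite subKr; lra.
have Ax0 : closed_ball x0 1%R x0 by exact: closed_ballxx.
have [p Ap pmin] := lsc_attains_min cA (ex_intro _ _ Ax0) lg gNy.
have fx0 : g x0 \is a fin_num by rewrite fin_numElt gNy.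
have fp : g p \is a fin_num.
  by rewrite fin_numElt gNy (le_lt_trans (pmin _ Ax0)).
set m := fine (g p); set s := fine (g x0).
have gpE : g p = m%:E by rewrite fineK.
have gx0E : g x0 = s%:E by rewrite fineK.
have ms : (m <= s)%R by rewrite -lee_fin -gpE -gx0E; exact: pmin.
(* Within distance 1 of [x0], [g v >= m]; at distance [d > 1], convexity gives
   [g v >= s - d * (s - m)], where [d <= |x0| + |v|]. The constant covers both cases. *)
exists (`|s| + `|m| + (s - m) * (1 + `|x0|))%R.
  by rewrite addr_ge0// ?addr_ge0// mulr_ge0// ?subr_ge0// addr_ge0.
move=> v; have := gNy v; case gvE : (g v) => [r| |]//; last by rewrite leey.
move=> _; rewrite lee_fin.
have Nv := normr_ge0 v; have Nx := normr_ge0 x0.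
have Ns := ler_norm (- s)%R; have Nm := ler_norm (- m)%R.
rewrite !normrN in Ns Nm.
have N's := normr_ge0 s; have N'm := normr_ge0 m.
have [d1|d1] := leP `|x0 - v|%R 1%R.
  have : g p <= g v by apply: pmin; rewrite closed_ballE.
  rewrite gpE gvE lee_fin => mr.
  have sm : (0 <= (s - m) * (1 + `|x0|))%R by rewrite mulr_ge0//; lra.
  nra.
have d0 : (0 < `|x0 - v|)%R by lra.
set d := `|x0 - v|%R in d1 d0 *.
have t01 : (0 <= d^-1 <= 1)%R by rewrite invr_ge0 ltW//= invf_le1// ltW.
have := cvx v x0 _ t01; rewrite gvE gx0E -!EFinM -EFinD.
have /pmin : closed_ball x0 1%R (d^-1 *: v + (1 - d^-1) *: x0)%R.
  rewrite closed_ballE// /closed_ball_ /=.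
  rewrite (_ : x0 - _ = d^-1 *: (x0 - v))%R; last first.
    by apply/rowP => i; rewrite !mxE; ring.
  by rewrite normrZ -/d gtr0_norm ?invr_gt0// mulVf// gt_eqF.
move=> /le_trans /[apply]; rewrite gpE lee_fin => key.
have : (d * m <= r + (d - 1) * s)%R.
  have := ler_wpM2l (ltW d0) key.
  by rewrite mulrDr !mulrA mulrBr mulr1 divff ?gt_eqF// mul1r.
have dle : (d <= `|x0| + `|v|)%R by exact: ler_normB.
have sm0 : (0 <= s - m)%R by lra.
have P1 := ler_wpM2r sm0 dle.
have P2 : (0 <= (s - m) * (1 + `|x0| * `|v|))%R.
  by rewrite mulr_ge0// addr_ge0// mulr_ge0.
have P3 : (0 <= (`|s| + `|m|) * `|v|)%R by rewrite mulr_ge0// addr_ge0.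
lra.
Qed.

(** The quadratic growth of [q] outweighs the at most linear decrease of [g], which bounds the
    sublevel set. *)
Lemma coercive_sublevel_compact g (q : 'rV[R]_n -> R) (e M : R) :
  convex_extended g -> lower_semicontinuous g -> (forall x, -oo < g x) ->
  continuous q -> (0 < e)%R -> (forall x, (e * `|x| ^+ 2 <= q x)%R) ->
  compact [set x | g x + (q x)%:E <= M%:E].
Proof.
move=> cvx lg gNy cq e0 qe.
have [C C0 gC] := convex_lsc_linear_growth cvx lg gNy.
(* For [|x| > 1], [e |x|^2 <= M + C (1 + |x|) <= (|M| + 2 C) |x|]. *)
apply: (@compact_norm_le _ (1 + (`|M| + 2 * C) / e)%R).
  exact: lsc_closed_sublevel (lscD_continuous lg cq).
move=> x /=; have := gC x; have := gNy x; case: (g x) => [r| |]// _.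
rewrite -EFinD !lee_fin => Cr rM.
have N0 := normr_ge0 x; have MM := ler_norm M; have M0 := normr_ge0 M.
have [|N1] := leP `|x|%R 1%R.
  by move=> /le_trans -> //; rewrite lerDl divr_ge0 ?(ltW e0)//; lra.
suff : (`|x| <= (`|M| + 2 * C) / e)%R by lra.
rewrite ler_pdivlMr//; have := qe x; nra.
Qed.

(** A minimiser over the compact sublevel set through [x0] is global, since values outside that set
    are larger. *)
Lemma coercive_attains_min g (q : 'rV[R]_n -> R) (e : R) :
  convex_extended g -> lower_semicontinuous g -> (forall x, -oo < g x) ->
  continuous q -> (0 < e)%R -> (forall x, (e * `|x| ^+ 2 <= q x)%R) ->
  (exists x, g x < +oo) ->
  exists2 v, g v < +oo & forall u, g v + (q v)%:E <= g u + (q u)%:E.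
Proof.
move=> cvx lg gNy cq e0 qe [x0 gx0].
have f0 : g x0 \is a fin_num by rewrite fin_numElt gNy.
set M := (fine (g x0) + q x0)%R.
have ME : M%:E = g x0 + (q x0)%:E by rewrite EFinD fineK.
have cM := @coercive_sublevel_compact g q e M cvx lg gNy cq e0 qe.
have [|x|v vM vmin] := lsc_attains_min cM _ (lscD_continuous lg cq).
- by exists x0 => /=; rewrite ME.
- by have := gNy x; case: (g x) => [r| |] //= _; rewrite -?EFinD ?ltNyr ?addye.
exists v; first by move: vM => /=; case: (g v) => [r _|//|_]; rewrite ?ltry ?ltNyr.
move=> u; have [/vmin//|/ltW uM] := leP (g u + (q u)%:E) M%:E.
exact: le_trans vM uM.
Qed.

(** This replaces a limit [t -> 0]: if [a < 0], then [t = - a / (1 - a + |b|)] makes [a + t * b]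
    negative. *)
Lemma affine_ge0_at0 (a b : R) :
  (forall t, 0 < t <= 1 -> 0 <= a + t * b)%R -> (0 <= a)%R.
Proof.
move=> H; rewrite leNgt; apply/negP => a0.
have b0 := normr_ge0 b; have bb := ler_norm b.
have den : (0 < 1 - a + `|b|)%R by lra.
have t0 : (0 < - a / (1 - a + `|b|))%R by rewrite divr_gt0// oppr_gt0.
have tE : (- a / (1 - a + `|b|) * (1 - a + `|b|) = - a)%R by rewrite divfK// gt_eqF.
have := H (- a / (1 - a + `|b|))%R.
rewrite t0 ler_pdivrMr// mul1r => /(_ ltac:(lra)).
set t := (- a / _)%R in t0 tE *; nra.
Qed.

(** The factor [1 / 2] gives the gradient the coordinates [w i * x_i]. *)
Definition half_quad (w : 'I_n -> R) x : R :=
  (1 / 2 * \sum_(i < n) w i * x ord0 i ^+ 2)%R.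

Lemma half_quad_continuous (w : 'I_n -> R) : continuous (half_quad w).
Proof.
have addc : continuous (fun z : R * R => z.1 + z.2)%R by exact: add_continuous.
have sqrc i : continuous (fun x : 'rV[R]_n => x ord0 i ^+ 2)%R.
  move=> x; apply: (@continuous_comp _ _ _ (fun y : 'rV[R]_n => y ord0 i)
    (fun z => z ^+ 2)%R); first exact: coord_continuous.
  exact: exprn_continuous.
have cstM (a : R) (f : 'rV[R]_n -> R) :
    continuous f -> continuous (fun x => a * f x)%R.
  by move=> cf x; exact: cvgMl_tmp (cf x).
by apply: (cstM); apply: (continuous_big addc) => i _; exact: (cstM).
Qed.

Lemma half_quad_ge (w : 'I_n -> R) (e : R) : (0 <= e)%R ->
  (forall i, (e <= w i)%R) -> forall x, (e / 2 * `|x| ^+ 2 <= half_quad w x)%R.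
Proof.
move=> e0 ew x; rewrite /half_quad.
suff : (e * `|x| ^+ 2 <= \sum_(i < n) w i * x ord0 i ^+ 2)%R by lra.
apply: le_trans (ler_wpM2l e0 (sqr_norm_le_sum x)) _.
by rewrite mulr_sumr; apply: ler_sum => i _; rewrite ler_wpM2r ?sqr_ge0.
Qed.

(* First-order optimality: minus the gradient of the quadratic is a subgradient
   of g at a minimiser. *)
Lemma quad_min_subgradient g (w : 'I_n -> R) v :
  convex_extended g -> (forall x, -oo < g x) -> g v < +oo ->
  (forall u, g v + (half_quad w v)%:E <= g u + (half_quad w u)%:E) ->
  g v - (dot v (\row_i (- w i * v ord0 i)))%:E <=
    h_fun g (\row_i (- w i * v ord0 i))%R.
Proof.
move=> cvx gNy gv vmin; set alpha := (\row_i _)%R; apply: le_ereal_inf_tmp => _ [u _ <-].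
have fv : g v \is a fin_num by rewrite fin_numElt gNy.
have gvE : g v = (fine (g v))%:E by rewrite fineK.
set s := fine (g v) in gvE; rewrite gvE.
have := gNy u; case guE : (g u) => [r| |]// _; last by rewrite leey.
rewrite -!EFinB lee_fin -subr_ge0.
(* Minimality of [v] against [t *: u + (1 - t) *: v], divided by [t], is an inequality affine in [t]
   whose constant term is the claim. *)
apply: (@affine_ge0_at0 _ (half_quad w (u - v)%R)) => t /andP[t0 t1].
have := vmin (t *: u + (1 - t) *: v)%R.
have := cvx u v t; rewrite t1 ltW// => /(_ isT).
move=> /(leeD2r (half_quad w (t *: u + (1 - t) *: v))%:E) c1 /le_trans /(_ c1).
rewrite gvE guE -!EFinM -!EFinD lee_fin => key.
suff E : (half_quad w (t *: u + (1 - t) *: v) =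
   half_quad w v + t * (dot v alpha - dot u alpha) + t ^+ 2 * half_quad w (u - v))%R.
  rewrite E in key.
  suff : (0 <= t * (r - dot u alpha - (s - dot v alpha) + t * half_quad w (u - v)))%R.
    by rewrite pmulr_rge0.
  lra.
rewrite /half_quad /dot !mulr_sumr -sumrB mulr_sumr -!big_split/=.
by apply: eq_bigr => i _; rewrite !mxE; field.
Qed.

End ConvexGrowth.

(** * Finite shifts of extended suprema and infima *)

Lemma ereal_sup_addl (R : realType) (T : Type) (A : set T) (F : T -> \bar R) (a : R) :
  ereal_sup [set a%:E + F x | x in A] = a%:E + ereal_sup [set F x | x in A].
Proof.
apply/eqP; rewrite eq_le; apply/andP; split.
  apply/ereal_supP => _ [x Ax <-]; apply: leeD2l.
  by apply: ereal_sup_ubound; exists x.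
rewrite addeC -leeBrDr//; apply/ereal_supP => _ [x Ax <-].
by rewrite leeBrDr// addeC; apply: ereal_sup_ubound; exists x.
Qed.

Lemma ereal_inf_addl (R : realType) (T : Type) (A : set T) (F : T -> \bar R) (a : R) :
  ereal_inf [set a%:E + F x | x in A] = a%:E + ereal_inf [set F x | x in A].
Proof.
apply/eqP; rewrite eq_le; apply/andP; split.
  rewrite addeC -leeBlDr//; apply/ereal_infP => _ [x Ax <-].
  by rewrite leeBlDr// addeC; apply: ereal_inf_lbound; exists x.
apply/ereal_infP => _ [x Ax <-]; apply: leeD2l.
by apply: ereal_inf_lbound; exists x.
Qed.

(** * The objectives as shifted dual and primal values *)

Section ValueFunctions.
Variables (R : realType) (n : nat) (c : 'rV[R]_n) (gamma : R).
Variables (g : 'rV[R]_n -> \bar R) (Omega : 'rV[R]_n -> R) (z : 'rV[R]_n).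
Hypotheses (z_binary : binary_vector z) (gamma_gt0 : (0 < gamma)%R).
Hypothesis g_gtNy : forall x, -oo < g x.
Hypothesis OmegaE : forall x, Omega x = (1 / (2 * gamma) * l2norm x ^+ 2)%R.

Lemma Omega_sum x : Omega x = (\sum_(i < n) 1 / (2 * gamma) * x ord0 i ^+ 2)%R.
Proof.
rewrite OmegaE /l2norm sqr_sqrtr ?mulr_sumr// sumr_ge0// => i _.
exact: sqr_ge0.
Qed.

Lemma sub_primal_infeasible : sub_infeasible g z -> sub_primal_value g Omega z = +oo.
Proof.
move=> inf; apply/ereal_inf_pinfty => _ [x zx <-] /=.
suff -> : g x = +oo by [].
by apply/eqP; rewrite -leye_eq leNgt; apply/negP => gx; apply: inf; exists x.
Qed.

(* The inner minimum over x is attained at x_i = - gamma z_i alpha_i. *)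
Lemma sub_dual_functionE alpha : sub_dual_function g Omega z alpha =
  h_fun g alpha - (gamma / 2 * \sum_(i < n) z ord0 i * alpha ord0 i ^+ 2)%:E.
Proof.
have g0 : gamma != 0%R by rewrite gt_eqF.
set K := (gamma / 2 * _)%R.
have KE : K = (\sum_(i < n) gamma / 2 * (z ord0 i * alpha ord0 i ^+ 2))%R.
  by rewrite /K mulr_sumr.
apply/eqP; rewrite eq_le; apply/andP; split.
  rewrite leeBrDr//; apply/ereal_infP => _ [v _ <-].
  rewrite -leeBrDr//; apply: ereal_inf_lbound.
  exists (v, \row_i (- gamma * (z ord0 i * alpha ord0 i)))%R => /=.
    by move=> i zi; rewrite mxE zi; ring.
  rewrite /sub_lagrangian -!addeA; congr (_ + _); rewrite -!EFinD; congr EFin.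
  rewrite Omega_sum KE /dot -!sumrN -!big_split/=; apply: eq_bigr => i _.
  by rewrite !mxE; case: (z_binary i) => ->; field.
apply/ereal_infP => _ [[v x] /= zx <-].
apply: (@le_trans _ _ ((g v - (dot v alpha)%:E) - K%:E)).
  by apply: leeD2r; apply: ereal_inf_lbound; exists v.
rewrite /sub_lagrangian -!addeA; apply: leeD2l; rewrite -!EFinD lee_fin.
rewrite Omega_sum KE /dot -!sumrN -!big_split/=; apply: ler_sum => i _.
rewrite !mxE -subr_ge0.
have [zi|zi] := z_binary i; rewrite zi ?(zx i zi).
  by rewrite le_eqVlt; apply/orP; left; apply/eqP; field.
(* For [z_i = 1] the gap is a complete square, zero at [x_i = - gamma * alpha_i]. *)
rewrite (_ : (_ - _)%R = ((x ord0 i + gamma * alpha ord0 i) ^+ 2 / (2 * gamma))%R).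
  by rewrite divr_ge0 ?sqr_ge0// mulr_ge0// ltW.
by field.
Qed.

Lemma saddle_objectiveE :
  saddle_objective c gamma g z = (dot c z)%:E + sub_dual_value g Omega z.
Proof.
rewrite /saddle_objective /sub_dual_value -ereal_sup_addl.
congr ereal_sup; apply: eq_imagel => alpha _.
by rewrite sub_dual_functionE addeA.
Qed.

Lemma sum_perspective_supported x : supported z x ->
  \sum_(i < n) perspective_term (x ord0 i) (z ord0 i) =
  (\sum_(i < n) x ord0 i ^+ 2)%:E.
Proof.
move=> zx; rewrite -sumEFin; apply: eq_bigr => i _; rewrite /perspective_term.
have [zi|->] := z_binary i; last by rewrite ltr01 divr1.
by rewrite zi zx// ltxx eqxx expr0n.
Qed.

Lemma sum_perspective_unsupported x : ~ supported z x ->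
  \sum_(i < n) perspective_term (x ord0 i) (z ord0 i) = +oo.
Proof.
move=> /existsNP[i /not_implyP[zi /eqP/negPf xi]].
rewrite (bigD1 i)//= {1}/perspective_term zi ltxx eqxx xi/= addye//.
(* The other terms are nonnegative, so their sum is not [-oo]. *)
rewrite gt_eqF// (lt_le_trans ltNy0)//; apply: sume_ge0 => j _.
rewrite /perspective_term; case: ifPn => [zj|_]; last by case: ifP.
by rewrite lee_fin divr_ge0 ?sqr_ge0// ltW.
Qed.

Lemma perspective_objectiveE :
  perspective_objective c gamma g z = (dot c z)%:E + sub_primal_value g Omega z.
Proof.
have valE x : supported z x -> (dot c z)%:E + g x + (1 / (2 * gamma))%:E *
    \sum_(i < n) perspective_term (x ord0 i) (z ord0 i) =
    (dot c z)%:E + (g x + (Omega x)%:E).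
  by move=> zx; rewrite sum_perspective_supported// -EFinM mulr_sumr -Omega_sum addeA.
rewrite /sub_primal_value -ereal_inf_addl; apply/eqP; rewrite eq_le; apply/andP.
split; apply/ereal_infP => _ [x zx <-].
  by rewrite -valE//; apply: ereal_inf_lbound; exists x.
move: zx => _; have [zx|nzx] := pselect (supported z x).
  by rewrite valE//; apply: ereal_inf_lbound; exists x.
rewrite sum_perspective_unsupported// gt0_muley ?lte_fin ?divr_gt0 ?mulr_gt0//.
by rewrite addey ?leey//; have := g_gtNy x; case: (g x).
Qed.

End ValueFunctions.

(** * Unboundedness of the dual for infeasible subproblems *)

Section Infeasible.
Variables (R : realType) (n : nat) (gamma : R).
Variables (g : 'rV[R]_n -> \bar R) (z : 'rV[R]_n).
Hypotheses (z_binary : binary_vector z) (gamma_gt0 : (0 < gamma)%R).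
Hypotheses (g_gtNy : forall x, -oo < g x) (g_convex : convex_extended g).
Hypotheses (g_lsc : lower_semicontinuous g) (z_infeasible : sub_infeasible g z).

(** With these weights [half_quad (w k)] is the ridge term plus the penalty [k / 2 * x_i^2] on the
    coordinates with [z_i = 0]. *)
Let w (k : nat) (i : 'I_n) : R := (gamma^-1 + k%:R * (1 - z ord0 i))%R.

Let w_ge k i : (gamma^-1 <= w k i)%R.
Proof.
by rewrite lerDl mulr_ge0//; case: (z_binary i) => ->; rewrite ?subr0 ?subrr.
Qed.

Let igamma_gt0 : (0 < gamma^-1)%R.
Proof. by rewrite invr_gt0. Qed.

Lemma penalty_unbounded (M : R) :
  exists k, forall x, M%:E < g x + (half_quad (w k) x)%:E.
Proof.
apply: contrapT => H.
have Fn0 k : [set x | g x + (half_quad (w k) x)%:E <= M%:E] !=set0.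
  apply: contrapT => F0; apply: H; exists k => x.
  by rewrite ltNge; apply/negP => Fx; apply: F0; exists x.
have [x Fx] : exists x : 'rV[R]_n, forall k, g x + (half_quad (w k) x)%:E <= M%:E.
  apply: (@nested_compact_nonempty _
    (fun k => [set x | g x + (half_quad (w k) x)%:E <= M%:E])) => //.
  - apply: (@coercive_sublevel_compact _ _ _ _ (gamma^-1 / 2)%R) => //.
    + exact: half_quad_continuous.
    + by rewrite divr_gt0.
    + by apply: half_quad_ge; rewrite ?ltW.
  - move=> k; apply: lsc_closed_sublevel; apply: lscD_continuous => //.
    exact: half_quad_continuous.
  - move=> k x /=; apply: le_trans; apply: leeD2l; rewrite lee_fin ler_wpM2l//.
    apply: ler_sum => i _; rewrite ler_wpM2r ?sqr_ge0// lerD2l.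
    rewrite ler_wpM2r ?ler_nat//.
    by case: (z_binary i) => ->; rewrite ?subr0 ?subrr.
have := g_gtNy x; have := Fx 0%N; case gxE : (g x) => [r| |]//= _ _.
apply: z_infeasible; exists x; split; last by rewrite gxE ltry.
move=> i zi; apply/eqP; rewrite -sqrf_eq0 eq_le sqr_ge0 andbT leNgt.
apply/negP => xi.
(* For this [k] the penalty on coordinate [i] alone exceeds [M - g x]. *)
have [k kM] : exists k : nat, (2 * (M - r) < k%:R * x ord0 i ^+ 2)%R.
  exists (Num.truncn (2 * (M - r) / x ord0 i ^+ 2)).+1.
  by rewrite -ltr_pdivrMr//; exact: truncnS_gt.
have := Fx k; rewrite gxE -EFinD lee_fin /half_quad (bigD1 i)//= /w zi subr0 mulr1.
have S0 : (0 <= \sum_(j < n | j != i)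
    (gamma^-1 + k%:R * (1 - z ord0 j)) * x ord0 j ^+ 2)%R.
  apply: sumr_ge0 => j _; rewrite mulr_ge0 ?sqr_ge0//.
  exact: le_trans (ltW igamma_gt0) (w_ge k j).
have X0 : (0 <= gamma^-1 * x ord0 i ^+ 2)%R by rewrite mulr_ge0 ?ltW.
lra.
Qed.

(* For alpha_i = - w_i v_i at the penalised minimiser v, the dual value is at
   least the penalised minimum since gamma z_i alpha_i^2 = z_i w_i v_i^2. *)
Lemma saddle_infeasible (c : 'rV[R]_n) : saddle_objective c gamma g z = +oo.
Proof.
(* A penalised minimiser with finite value requires [g] finite somewhere; if [g] is [+oo]
   everywhere, [alpha = 0] already gives [+oo]. *)
have [gF|noF] := pselect (exists x, g x < +oo); last first.
  have gy v : g v = +oo.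
    by apply/eqP; rewrite -leye_eq leNgt; apply/negP => gv; apply: noF; exists v.
  apply: ereal_supy; exists 0%R => //.
  suff -> : h_fun g 0%R = +oo by [].
  by apply/ereal_inf_pinfty => _ [v _ <-]; rewrite gy.
apply/eqyP => A _.
have [k Ak] := penalty_unbounded (A - dot c z).
have [v gv vmin] := @coercive_attains_min _ _ g (half_quad (w k)) (gamma^-1 / 2)%R
  g_convex g_lsc g_gtNy (@half_quad_continuous _ _ _)
  (divr_gt0 igamma_gt0 (ltr0Sn _ _)) (half_quad_ge (ltW igamma_gt0) (w_ge k)) gF.
have := quad_min_subgradient g_convex g_gtNy gv vmin.
set alpha := (\row_i _)%R => hge.
apply: (@le_trans _ _ ((dot c z)%:E + h_fun g alpha -
    (gamma / 2 * \sum_(i < n) z ord0 i * alpha ord0 i ^+ 2)%:E)); last first.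
  by apply: ereal_sup_ubound; exists alpha.
apply: (@le_trans _ _ ((dot c z)%:E + (g v - (dot v alpha)%:E) -
    (gamma / 2 * \sum_(i < n) z ord0 i * alpha ord0 i ^+ 2)%:E)); last first.
  by apply: leeD2r; exact: leeD2l.
have := Ak v; have := g_gtNy v; case: (g v) gv => [r| |]// _ _.
rewrite -!EFinD lte_fin lee_fin => /ltW.
(* Coordinatewise, the sum is [- w_i v_i^2 / 2] if [z_i = 0], and cancels if [z_i = 1] because then
   [w_i = 1 / gamma]. *)
suff : (half_quad (w k) v + dot v alpha +
  gamma / 2 * (\sum_(i < n) z ord0 i * alpha ord0 i ^+ 2) <= 0)%R by lra.
rewrite /half_quad /dot !mulr_sumr -!big_split/=; apply: sumr_le0 => i _.
rewrite !mxE /w; have g0 : gamma != 0%R by rewrite gt_eqF.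
have V0 : (0 <= v ord0 i ^+ 2)%R by exact: sqr_ge0.
have P1 : (0 <= gamma^-1 * v ord0 i ^+ 2)%R by rewrite mulr_ge0// ltW.
have P2 : (0 <= k%:R * v ord0 i ^+ 2)%R by rewrite mulr_ge0.
case: (z_binary i) => ->.
  lra.
rewrite (_ : (_ + _)%R = 0%R)//; by field.
Qed.

End Infeasible.

Theorem theorem3p2 (R : realType) (n : nat) (Z : set 'rV[R]_n)
    (c : 'rV[R]_n) (gamma : R) (g : 'rV[R]_n -> \bar R)
    (Omega : 'rV[R]_n -> R)
    (Z_binary : Z `<=` @binary_vector R n)
    (gamma_gt0 : (0 < gamma)%R)
    (g_gtNy : forall x, -oo < g x)
    (g_convex : convex_extended g)
    (OmegaE : forall x, Omega x = (1 / (2 * gamma) * l2norm x ^+ 2)%R)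
    (infeasible_or_duality : forall z, Z z ->
       sub_infeasible g z \/ strong_duality g Omega z)
    (* closedness is needed only when some subproblem is infeasible *)
    (g_closed : (exists2 z, Z z & sub_infeasible g z) ->
       lower_semicontinuous g) :
  equivalent_min Z (saddle_objective c gamma g)
                   (perspective_objective c gamma g).
Proof.
(* Pointwise equality on [Z] suffices: optimal values and minimisers then agree. *)
have objE z : Z z -> saddle_objective c gamma g z = perspective_objective c gamma g z.
  move=> Zz; have zb := Z_binary z Zz.
  rewrite (perspective_objectiveE c zb gamma_gt0 g_gtNy OmegaE).
  case: (infeasible_or_duality z Zz) => [inf|sd].
    rewrite sub_primal_infeasible// addey//.
    by apply: saddle_infeasible => //; apply: g_closed; exists z.
  by rewrite (saddle_objectiveE c g zb gamma_gt0 OmegaE) -sd.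
have optE z : optimal Z (saddle_objective c gamma g) z <->
    optimal Z (perspective_objective c gamma g) z.
  split=> -[Zz opt]; split=> // z' Zz'.
    by rewrite -!objE//; exact: opt.
  by rewrite !objE//; exact: opt.
split=> //; congr ereal_inf; exact: eq_imagel.
Qed.
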